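(* Let $X$ be a set of $n$ points in the plane $\mathbb{R}^2$ with the $L_\infty$ metric. If there is no universal line, then $X$ induces at least $\lceil n/2\rceil$ lines.
   Context: The $L_\infty$ metric on $\mathbb{R}^2$ is $\rho((u_1,u_2),(v_1,v_2))=\max(|u_1-v_1|,|u_2-v_2|)$. For points of $X$, $z$ is between $x$ and $y$ if $x,y,z$ are distinct and $\rho(x,y)=\rho(x,z)+\rho(z,y)$. For a pair $\{u,v\}$ of points of $X$, the line $\overline{uv}$ is the subset of $X$ consisting of $u$, $v$ and all points $w\in X$ such that one of $u,v,w$ is between the other two; the pair $\{u,v\}$ is said to induce the line $\overline{uv}$. The lines induced by $X$ are the distinct sets $\overline{uv}$ induced by pairs of points of $X$. A universal line is a line containing all of $X$.
   Formalization: The case n = 1 is excluded: a single point induces no line, hence has no universal line, yet the claim would require at least one line. *)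

(* Defs.v *)
From mathcomp Require Import all_boot all_order all_algebra finmap reals.

Set Implicit Arguments.
Unset Strict Implicit.
Unset Printing Implicit Defensive.

Import Order.TTheory GRing.Theory Num.Theory.
Local Open Scope ring_scope.

Definition linf_dist (R : realType) (u v : R * R) : R :=
  Num.max `|u.1 - v.1| `|u.2 - v.2|.

(* The middle argument is the point lying between the other two. *)
Definition between (R : realType) (x z y : R * R) : bool :=
  [&& x != y, x != z, z != y &
      linf_dist x y == linf_dist x z + linf_dist z y].

Definition line (R : realType) (X : {fset (R * R)%type}) (u v : R * R) :
    {fset (R * R)%type} :=
  [fset w in X | [|| w == u, w == v, between u w v, between w u v
                   | between u v w]]%fset.

(* As a finite set of subsets of X: a line induced by several pairs counts
   once. *)
Definition lines (R : realType) (X : {fset (R * R)%type}) :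
    {fset {fset (R * R)%type}} :=
  [fset line X u v | u in X, v in X & u != v]%fset.

Definition universal (R : realType) (X L : {fset (R * R)%type}) : bool :=
  (L \in lines X) && (X `<=` L)%fset.

(* Main.v *)
Require Import Defs.
From mathcomp Require Import all_boot all_order all_algebra finmap reals.
From mathcomp Require Import zify lra boolp.

(**
In the coordinates [x + y], [x - y] the metric is half the L1 metric, so three
points are collinear iff one of them lies in the bounding box of the other two;
only the ranks [a] (column) and [b] (row) of the coordinates matter. Let [c] be
the number of columns.

At least [c - 1] lines. For each pair of adjacent columns [j], [j + 1] take
points [p], [q] in them with no other point of these columns in the rows between,
and the line [pq]. When several values of [j] give the same line, the last one
keeps it, and every other one is given a line crossing the block of columns up to
the next one, which misses [p]; all these lines are different.

At least [n - c + 1] lines. For a point [u] that is not the top of its column,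
let [u'] be the next point above it. As [uu'] is not universal, the open strip of
rows between them contains a point. If there is one to the right of [u], take the
leftmost, then lowest, such point [z] and the line [uz]; otherwise mirror. Two
such lines can only agree for points of a single row on the same side, and there
all but the first point are given the horizontal line to the first one. None of
the lines obtained is closed under moving up in a column, except possibly these
horizontal ones; some line through the top row is, and it is not one of them.

Finally [max (c - 1) (n - c + 1) >= n / 2].
*)

Set Implicit Arguments.
Unset Strict Implicit.
Unset Printing Implicit Defensive.

Import Order.TTheory GRing.Theory Num.Theory.
Local Open Scope ring_scope.

(** * Collinearity in ranked coordinates *)

Section Lines.
Variable T : finType.
Implicit Types (a b : T -> int) (s t u v w x y z : T) (L : {set T}).

Definition inbox a b u w v :=
  ((a u <= a w <= a v) || (a v <= a w <= a u)) &&
  ((b u <= b w <= b v) || (b v <= b w <= b u)).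

Definition ln a b u v : {set T} :=
  [set w | [|| inbox a b u w v, inbox a b w u v | inbox a b u v w]].

Lemma lnC a b u v : ln a b u v = ln a b v u.
Proof. by apply/setP => w; rewrite !inE /inbox; lia. Qed.

Lemma ln_negb a b u v : ln a (fun t => - b t) u v = ln a b u v.
Proof. by apply/setP => w; rewrite !inE /inbox; lia. Qed.

Lemma ln_nega a b u v : ln (fun t => - a t) b u v = ln a b u v.
Proof. by apply/setP => w; rewrite !inE /inbox; lia. Qed.

(* Weak comparability in the product order of columns and rows; [dcomp] is the
   same with the rows reversed. *)
Definition icomp a b w u :=
  ((a w <= a u) && (b w <= b u)) || ((a u <= a w) && (b u <= b w)).

Definition dcomp a b w u :=
  ((a w <= a u) && (b u <= b w)) || ((a u <= a w) && (b w <= b u)).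

Lemma ln_inc a b u v w : a u < a v -> b u < b v ->
  (w \in ln a b u v) = icomp a b w u && icomp a b w v.
Proof. by rewrite inE /inbox /icomp; lia. Qed.

Lemma ln_dec a b u v w : a u < a v -> b v < b u ->
  (w \in ln a b u v) = dcomp a b w u && dcomp a b w v.
Proof. by rewrite inE /inbox /dcomp; lia. Qed.

Lemma mem_lnl a b u v : u \in ln a b u v.
Proof. by rewrite inE /inbox; lia. Qed.

Lemma mem_lnr a b u v : v \in ln a b u v.
Proof. by rewrite inE /inbox; lia. Qed.

Lemma icomp_dcomp a b w u : icomp a b w u -> dcomp a b w u -> a w = a u \/ b w = b u.
Proof. by rewrite /icomp /dcomp; lia. Qed.

Lemma dcompC a b w u : dcomp a b w u = dcomp a b u w.
Proof. by rewrite /dcomp orbC. Qed.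

(** Each of [s], [t] is comparable to each of [x], [y] in both orders, so by [icomp_dcomp] it shares
    a row or a column with each; the strict inequalities leave only the other two corners of the
    box. *)
Lemma ln_rectangle a b x y s t :
  a x < a y -> b y < b x -> a s < a t -> b s < b t ->
  ln a b x y = ln a b s t ->
  [/\ a s = a x, b s = b y, a t = a y & b t = b x].
Proof.
move=> axy byx ast bst E.
have := mem_lnl a b x y; have := mem_lnr a b x y.
rewrite {1 2}E !(ln_inc _ ast bst) => /andP[ys yt] /andP[xs xt].
have := mem_lnl a b s t; have := mem_lnr a b s t.
rewrite -{1 2}E !(ln_dec _ axy byx) => /andP[tx ty] /andP[sx sy].
have := icomp_dcomp xs; have := icomp_dcomp xt; have := icomp_dcomp ys.
have := icomp_dcomp yt; rewrite !(dcompC _ _ x) !(dcompC _ _ y).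
move=> /(_ ty) h1 /(_ sy) h2 /(_ tx) h3 /(_ sx) h4.
clear tx ty sx sy xs xt ys yt E.
by case: h2 => ?; case: h4 => ?; case: h1 => ?; case: h3 => ?; split; lia.
Qed.

(* [p] and [q] are consecutive among the rows met by the columns [j] and [j + 1]. *)
Definition step a b j p q :=
  [/\ a p = j, a q = j + 1, b p != b q &
      forall w, (a w = j -> ~~ (b p < b w <= b q) /\ ~~ (b q <= b w < b p)) /\
        (a w = j + 1 -> ~~ (b p <= b w < b q) /\ ~~ (b q < b w <= b p))].

Lemma step_negb a b j p q : step a b j p q -> step a (fun t => - b t) j p q.
Proof.
by case=> ap aq bpq H; split=> //; [lia|move=> w; move: (H w); lia].
Qed.

Lemma ln_stepU a b j p q w : step a b j p q -> b p < b q ->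
  (w \in ln a b p q) =
  ((a w <= j) && (b w <= b p)) || ((j < a w) && (b q <= b w)).
Proof. by case=> ap aq _ /(_ w) H bpq; rewrite ln_inc /icomp; lia. Qed.

Lemma ln_stepD a b j p q w : step a b j p q -> b q < b p ->
  (w \in ln a b p q) =
  ((a w <= j) && (b p <= b w)) || ((j < a w) && (b w <= b q)).
Proof. by case=> ap aq _ /(_ w) H bpq; rewrite ln_dec /dcomp; lia. Qed.

Lemma ln_stepUl a b j p q w : step a b j p q -> b p < b q -> a w <= j ->
  (w \in ln a b p q) = (b w <= b p).
Proof. by move=> H bpq aw; rewrite (ln_stepU _ H bpq) aw ltNge aw orbF. Qed.

Lemma ln_stepUr a b j p q w : step a b j p q -> b p < b q -> j < a w ->
  (w \in ln a b p q) = (b q <= b w).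
Proof. by move=> H bpq aw; rewrite (ln_stepU _ H bpq) aw leNgt aw. Qed.

Lemma ln_stepDl a b j p q w : step a b j p q -> b q < b p -> a w <= j ->
  (w \in ln a b p q) = (b p <= b w).
Proof. by move=> H bpq aw; rewrite (ln_stepD _ H bpq) aw ltNge aw orbF. Qed.

Lemma ln_stepDr a b j p q w : step a b j p q -> b q < b p -> j < a w ->
  (w \in ln a b p q) = (b w <= b q).
Proof. by move=> H bpq aw; rewrite (ln_stepD _ H bpq) aw leNgt aw. Qed.

(** * Lines of adjacent columns and lines crossing their blocks *)

Section Columns.
Variables (a b : T -> int) (P Q : int -> T) (vl : pred int).
Hypothesis HPQ : forall j, vl j -> step a b j (P j) (Q j).

Definition ell j := ln a b (P j) (Q j).

(** Otherwise the common line, which contains [P i] and [P j], would give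
    [b (P i) < b (Q i) <= b (P j) <= b (P i)]. *)
Lemma ell_type i j : vl i -> vl j -> i < j -> ell i = ell j ->
  b (P i) < b (Q i) -> b (P j) < b (Q j).
Proof.
move=> vi vj ij /setP E up; case: ltP => // dn.
have [aPi aQi _ _] := HPQ vi; have [aPj aQj neq _] := HPQ vj.
have {neq} dn : b (Q j) < b (P j) by lia.
move: (E (P i)) (E (P j)).
rewrite /ell !(ln_stepU _ (HPQ vi) up) !(ln_stepD _ (HPQ vj) dn); lia.
Qed.

(* If [ell i = ell j] with [i < j], the columns in between occupy only the rows
   from [Q i] to [P j], and no point of the other columns is in these rows. *)
Lemma ell_block i j w : vl i -> vl j -> i < j -> ell i = ell j ->
  b (P i) < b (Q i) ->
  [/\ a w <= i -> (b w <= b (P i)) = (b w <= b (P j)),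
      i < a w <= j -> b (Q i) <= b w <= b (P j) &
      j < a w -> (b (Q i) <= b w) = (b (Q j) <= b w)].
Proof.
move=> vi vj ij E up; have upj := ell_type vi vj ij E up.
have [aPi aQi _ _] := HPQ vi; have [aPj aQj _ _] := HPQ vj.
move/setP: E => E; move: (E (P i)) (E (Q i)) (E w).
rewrite /ell !(ln_stepU _ (HPQ vi) up) !(ln_stepU _ (HPQ vj) upj).
by move=> *; split; lia.
Qed.

Definition next i i' :=
  [/\ vl i', i < i', ell i = ell i' &
      forall k, i < k < i' -> vl k -> ell k != ell i].

Definition upper i z :=
  [/\ a z <= i, b (P i) < b z & forall w, a w <= i -> b w <= b z].

(** The last clause makes [lower] exclude [upper]; [cross_inj_mixed] relies on it. *)
Definition lower i z :=
  [/\ i < a z, b z < b (Q i), forall w, i < a w -> b z <= b w &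
      forall w, a w <= i -> b w <= b (P i)].

(* The line given to [i] when [i'] is the next pair of columns with the same
   line: it runs through the block of [ell_block] from its upper left quadrant or
   into its lower right one, as [ell i] misses a point of one of these. *)
Definition cross i i' z L :=
  [/\ vl i, b (P i) < b (Q i), next i i' &
      (upper i z /\ L = ln a b z (Q i)) \/ (lower i z /\ L = ln a b (P i') z)].

Lemma cross_exists i i' : vl i -> b (P i) < b (Q i) -> next i i' ->
  (exists w, w \notin ell i) -> exists z L, cross i i' z L.
Proof.
move=> vi up nx [w Hw].
case: (boolP [exists w, (a w <= i) && (b (P i) < b w)]) => [/existsP[w0 /andP[aw0 bw0]]|].
  have [z az Hz] := @arg_maxP _ _ _ w0 (fun w => a w <= i) b aw0.
  exists z, (ln a b z (Q i)); split => //; left; split => //.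
  split => //; apply: lt_le_trans bw0 _; exact: Hz.
rewrite negb_exists => /forallP noU.
rewrite /ell (ln_stepU _ (HPQ vi) up) in Hw.
have iw : i < a w by move: (noU w); lia.
have [z az Hz] := @arg_minP _ _ _ w (fun w => i < a w) b iw.
exists z, (ln a b (P i') z); split => //; right; split => //.
split => //; first by move: (Hz w iw); lia.
by move=> x; move: (noU x); lia.
Qed.

Lemma upper_ln i i' z w : vl i -> b (P i) < b (Q i) -> next i i' ->
  upper i z ->
  (w \in ln a b z (Q i)) = dcomp a b w z && dcomp a b w (Q i).
Proof.
move=> vi up [vi' ii' E _] [az bz _]; have [aPi aQi _ _] := HPQ vi.
have [h1 _ _] := ell_block z vi vi' ii' E up.
have [_ h2 _] := ell_block (Q i) vi vi' ii' E up.
by apply: ln_dec; move: (h1 az) h2; lia.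
Qed.

Lemma lower_ln i i' z w : vl i -> b (P i) < b (Q i) -> next i i' ->
  lower i z ->
  (w \in ln a b (P i') z) = dcomp a b w (P i') && dcomp a b w z.
Proof.
move=> vi up [vi' ii' E _] [az bz _ _]; have [aPi aQi _ _] := HPQ vi'.
have [_ h1 h2] := ell_block z vi vi' ii' E up.
have [_ h3 _] := ell_block (P i') vi vi' ii' E up.
by apply: ln_dec; move: h1 h2 h3; lia.
Qed.

(** [L] is decreasing; [P i] lies strictly below and left of its end in the block, [Q i'] strictly
    above and right of it. *)
Lemma cross_out i i' z L : cross i i' z L -> (P i \notin L) /\ (Q i' \notin L).
Proof.
case=> vi up nx [] [Hz ->];
  [rewrite !(upper_ln _ vi up nx Hz)|rewrite !(lower_ln _ vi up nx Hz)];
  case: nx => vi' ii' E _; have [aPi aQi _ _] := HPQ vi;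
  have [aPi' aQi' _ _] := HPQ vi';
  have [_ h3 _] := ell_block (P i') vi vi' ii' E up;
  have upi' := ell_type vi vi' ii' E up;
  have [_ h2 _] := ell_block (Q i) vi vi' ii' E up;
  rewrite /dcomp; move: h3 h2; lia.
Qed.

(** The rows of [P i], [Q i], [P i'], [Q i'] increase weakly in this order, and [L] contains one of
    the two middle points but neither outer one. *)
Lemma cross_ell i i' z L j : cross i i' z L -> vl j -> L <> ell j.
Proof.
move=> C vj LE; have [] := cross_out C.
case: C => vi up nx H; have [vi' ii' E _] := nx.
have [aPi aQi _ _] := HPQ vi; have [aPi' aQi' _ _] := HPQ vi'.
have [aPj aQj neq _] := HPQ vj.
have upi' := ell_type vi vi' ii' E up.
have [_ h1 _] := ell_block (P i') vi vi' ii' E up.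
have [_ h2 _] := ell_block (Q i) vi vi' ii' E up.
have [_ h3 _] := ell_block (P j) vi vi' ii' E up.
have [_ h4 _] := ell_block (Q j) vi vi' ii' E up.
have {}h1 : b (Q i) <= b (P i') by move: h1; rewrite aPi'; lia.
have {}h3 : i < j <= i' -> b (Q i) <= b (P j) <= b (P i').
  by rewrite -{1 2}aPj; exact: h3.
have {}h4 : i <= j < i' -> b (Q i) <= b (Q j) <= b (P i').
  by move=> ?; apply: h4; rewrite aQj; lia.
have M : (Q i \in L) || (P i' \in L).
  by case: H => [] [_ ->]; rewrite ?mem_lnl ?mem_lnr ?orbT.
move: M; rewrite {}LE /ell => M; clear H nx E h2.
(* All four points are to the right of column [j], where membership in [ell j] is monotone in the
   row. The case [i' < j] is symmetric. *)
have [ji|ij] := ltP j i.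
  have [r1 r2 r3 r4] : [/\ j < a (P i), j < a (Q i), j < a (P i') & j < a (Q i')].
    by split; lia.
  move: M; have [upj|dnj] := ltP (b (P j)) (b (Q j)).
    by rewrite !(ln_stepUr (HPQ vj) upj) //; lia.
  have {}dnj : b (Q j) < b (P j) by rewrite lt_neqAle eq_sym neq.
  by rewrite !(ln_stepDr (HPQ vj) dnj) //; lia.
have [i'j|ji'] := ltP i' j.
  have [r1 r2 r3 r4] : [/\ a (P i) <= j, a (Q i) <= j, a (P i') <= j & a (Q i') <= j].
    by split; lia.
  move: M; have [upj|dnj] := ltP (b (P j)) (b (Q j)).
    by rewrite !(ln_stepUl (HPQ vj) upj) //; lia.
  have {}dnj : b (Q j) < b (P j) by rewrite lt_neqAle eq_sym neq.
  by rewrite !(ln_stepDl (HPQ vj) dnj) //; lia.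
(* Now [i <= j <= i']: by the rows of the block an increasing [ell j] contains [P i], and a
   decreasing one contains neither [Q i] nor [P i']. *)
have [l1 r2] : a (P i) <= j /\ j < a (Q i') by split; lia.
have [upj|dnj] := ltP (b (P j)) (b (Q j)).
  rewrite (ln_stepUl (HPQ vj) upj l1) -ltNge => bPj _.
  have [ij'|] := ltP i j; first by move: h3; rewrite ij' ji' => /(_ isT); lia.
  by move=> ji; move: bPj; rewrite (_ : j = i) ?ltxx //; apply/le_anti; rewrite ij ji.
have {}dnj : b (Q j) < b (P j) by rewrite lt_neqAle eq_sym neq.
have {}ij : i < j.
  by rewrite lt_neqAle ij andbT; apply: contraTneq up => ->; rewrite -leNgt ltW.
have {}ji' : j < i'.
  by rewrite lt_neqAle ji' andbT; apply: contraTneq upi' => <-; rewrite -leNgt ltW.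
have [l3 r4] : a (Q i) <= j /\ j < a (P i') by split; lia.
move: M h3 h4; rewrite (ln_stepDl (HPQ vj) dnj l3) (ln_stepDr (HPQ vj) dnj r4).
by rewrite ij ji' (ltW ij) (ltW ji') => M /(_ isT) ? /(_ isT) ? _ _; lia.
Qed.

(* An increasing line equal to a decreasing one has all four corners of its box
   (lemma [ln_rectangle]); a missing corner separates [cross] from its mirror. *)
Lemma cross_corner i i' z L : cross i i' z L ->
  exists x y, [/\ a x < a y, b y < b x, L = ln a b x y &
    (forall w, ~~ ((a w == a y) && (b w == b x))) \/
    (forall w, ~~ ((a w == a x) && (b w == b y)))].
Proof.
case=> vi up [vi' ii' E _] H.
have [aPi aQi _ _] := HPQ vi; have [aPi' aQi' _ _] := HPQ vi'.
have [_ h1 _] := ell_block (P i') vi vi' ii' E up.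
have [_ h2 _] := ell_block (Q i) vi vi' ii' E up.
have [hz1 hz2 hz3] := ell_block z vi vi' ii' E up.
case: H => [[[az bz Hz] ->]|[[az bz Hz _] ->]].
  exists z, (Q i); split=> //; [by lia|by move: (hz1 az) h2; lia|left=> w].
  have [_ h3 _] := ell_block w vi vi' ii' E up; move: (hz1 az) h3; lia.
exists (P i'), z; split=> //; [by lia|by lia|right=> w].
have [_ h3 _] := ell_block w vi vi' ii' E up; move: h3; lia.
Qed.

(** [Q i] is on the line ending at [Q j], hence not below [Q j]. If [j < i'] the block of [i]
    contradicts this; if [i' <= j] then [Q i'] would be on [L], against [cross_out]. *)
Lemma cross_inj_upper i i' z j j' x L :
  cross i i' z L -> cross j j' x L -> upper i z -> upper j x ->
  L = ln a b z (Q i) -> L = ln a b x (Q j) -> i < j -> False.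
Proof.
move=> Ci Cj Ui Uj Ei Ej ij; have [_ Qi'L] := cross_out Ci.
have [[vi upi nxi _] [vj upj nxj _]] := (Ci, Cj).
have [[aPi aQi _ _] [aPj aQj _ _]] := (HPQ vi, HPQ vj).
have := mem_lnr a b z (Q i); rewrite -Ei Ej (upper_ln _ vj upj nxj Uj).
case/andP => mi1 mi2; have bji : b (Q j) <= b (Q i) by move: mi2; rewrite /dcomp; lia.
have [vi' ii' Eii _] := nxi; have [aPi' aQi' _ _] := HPQ vi'.
have [ji'|i'j|i'j] := ltgtP j i'.
- have [_ h3 _] := ell_block (P j) vi vi' ii' Eii upi.
  have [_ h4 _] := ell_block (Q j) vi vi' ii' Eii upi.
  by move: h3 h4; clear mi1 mi2; lia.
- have upi' := ell_type vi vi' ii' Eii upi.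
  have [_ h2 _] := ell_block (Q i) vi vi' ii' Eii upi.
  move: Qi'L; rewrite Ej (upper_ln _ vj upj nxj Uj).
  have [_ _ /(_ (Q i'))] := Uj.
  have {}h2 : b (Q i) < b (Q i') by lia.
  by clear mi2; move: mi1; rewrite /dcomp; lia.
- by move: Qi'L; rewrite -i'j Ej mem_lnr.
Qed.

(** The argument of [cross_inj_upper] after a half-turn: the right ends of the blocks are compared
    instead of the left ones. *)
Lemma cross_inj_lower i i' z j j' x L :
  cross i i' z L -> cross j j' x L -> lower i z -> lower j x ->
  L = ln a b (P i') z -> L = ln a b (P j') x -> j' < i' -> False.
Proof.
move=> Ci Cj Li Lj Ei Ej ji'; have [PiL _] := cross_out Ci.
have [[vi upi nxi _] [vj upj nxj _]] := (Ci, Cj).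
have [[vi' ii' Eii _] [vj' jj' Ejj _]] := (nxi, nxj).
have [[aPi aQi _ _] [aPj aQj _ _]] := (HPQ vi', HPQ vj').
have := mem_lnl a b (P i') z; rewrite -Ei Ej (lower_ln _ vj upj nxj Lj).
case/andP => mi1 mi2; have bji : b (P i') <= b (P j') by move: mi1; rewrite /dcomp; lia.
have [j'i|ij'|j'i] := ltgtP j' i.
- have [aPii aQii _ _] := HPQ vi.
  have [_ h2 _] := ell_block (Q i) vi vi' ii' Eii upi.
  move: PiL; rewrite Ej (lower_ln _ vj upj nxj Lj).
  have [_ _ /(_ (P i)) h _] := Lj.
  have {}h2 : b (P i) < b (P i') by lia.
  by clear mi1; move: mi2 h; rewrite /dcomp; lia.
- have upj' := ell_type vj vj' jj' Ejj upj.
  have [_ h3 _] := ell_block (P j') vi vi' ii' Eii upi.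
  have [_ h4 _] := ell_block (Q j') vi vi' ii' Eii upi.
  by move: h3 h4; clear mi1 mi2; lia.
- by move: PiL; rewrite -j'i Ej mem_lnl.
Qed.

(** If [j' <= i], then [Q j'] or [P i] would be on [L], against [cross_out]. If [i < j'], the empty
    upper left quadrant of [P j] forces [j < i], and then [z] would be both above [P j'] and not
    above it. *)
Lemma cross_inj_mixed i i' z j j' x L :
  cross i i' z L -> cross j j' x L -> upper i z -> lower j x ->
  L = ln a b z (Q i) -> L = ln a b (P j') x -> False.
Proof.
move=> Ci Cj Ui Lj Ei Ej; have [PiL _] := cross_out Ci; have [_ Qj'L] := cross_out Cj.
have [[vi upi nxi _] [vj upj nxj _]] := (Ci, Cj).
have [[vi' ii' Eii _] [vj' jj' Ejj _]] := (nxi, nxj).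
have [[aPi aQi _ _] [aPj aQj _ _]] := (HPQ vi, HPQ vj).
have [aPj' aQj' _ _] := HPQ vj'.
have := mem_lnr a b z (Q i); rewrite -Ei Ej (lower_ln _ vj upj nxj Lj).
case/andP => m1 _; have := mem_lnl a b (P j') x; rewrite -Ej Ei (upper_ln _ vi upi nxi Ui).
case/andP => m2 _.
have [j'i|ij'|j'i] := ltgtP j' i.
- have upj' := ell_type vj vj' jj' Ejj upj.
  move: Qj'L; rewrite Ei (upper_ln _ vi upi nxi Ui).
  have [_ _ /(_ (Q j'))] := Ui.
  have {}m1 : b (Q i) <= b (P j') by move: m1; clear m2; rewrite /dcomp; lia.
  by move: m2; rewrite /dcomp; lia.
- have [az bz Hz] := Ui; have [_ _ _ Hj] := Lj.
  have [_ h1 _] := ell_block (Q j) vj vj' jj' Ejj upj.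
  have {}h1 : b (Q j) <= b (P j') by lia.
  have {}m1 : i + 1 < j' -> b (P j') <= b (Q i).
    by move: m1; clear m2; rewrite /dcomp; lia.
  have [ij|ji] := ltP i j; first by move: (Hj (Q i)); clear m2; lia.
  have {}ji : j < i.
    rewrite lt_neqAle ji andbT; apply/eqP => ji'; subst j.
    by move: (Hj z az); rewrite leNgt bz.
  have [_ h2 _] := ell_block (Q i) vj vj' jj' Ejj upj.
  have [_ h3 _] := ell_block z vj vj' jj' Ejj upj.
  have [k1 k2 _] := ell_block z vi vi' ii' Eii upi.
  have [_ k3 _] := ell_block (P j') vi vi' ii' Eii upi.
  have [_ k4 _] := ell_block (Q i) vi vi' ii' Eii upi.
  have {k1}bz' : b (P i') < b z by move: (k1 az); lia.
  by move: (Hj z); clear m2 Hj Hz k2; lia.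
- by move: PiL; rewrite -j'i Ej mem_lnl.
Qed.

Lemma next_inj i j k : vl i -> vl j -> next i k -> next j k -> i = j.
Proof.
move=> vi vj [_ ik Ei Hi] [_ jk Ej Hj].
have [ij|ji|//] := ltgtP i j.
  by move: (Hi j); rewrite ij jk => /(_ isT vj)/eqP []; rewrite Ej.
by move: (Hj i); rewrite ji ik => /(_ isT vi)/eqP []; rewrite Ei.
Qed.

Lemma cross_inj i i' z j j' x L :
  cross i i' z L -> cross j j' x L -> i = j.
Proof.
move=> Ci Cj; have [[vi upi nxi Hi] [vj upj nxj Hj]] := (Ci, Cj).
case: Hi Hj => [[Ui Ei]|[Li Ei]] [[Uj Ej]|[Lj Ej]].
- have [ij|ji|//] := ltgtP i j.
    by case: (cross_inj_upper Ci Cj Ui Uj Ei Ej ij).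
  by case: (cross_inj_upper Cj Ci Uj Ui Ej Ei ji).
- by case: (cross_inj_mixed Ci Cj Ui Lj Ei Ej).
- by case: (cross_inj_mixed Cj Ci Uj Li Ej Ei).
- have [ij|ji|ij] := ltgtP i' j'.
  + by case: (cross_inj_lower Cj Ci Lj Li Ej Ei ij).
  + by case: (cross_inj_lower Ci Cj Li Lj Ei Ej ji).
  + by apply: next_inj nxi _ => //; rewrite ij.
Qed.

End Columns.

End Lines.

(** * Counting columns *)

(** Lines are assigned by cases, so the assignment is kept as a relation; choice turns it into an
    injection. *)
Lemma card_le_rel (T : finType) (D : {set T}) (LS : {set {set T}})
    (Rel : T -> {set T} -> Prop) :
  (forall u, u \in D -> exists2 L, L \in LS & Rel u L) ->
  (forall u v L, u \in D -> v \in D -> Rel u L -> Rel v L -> u = v) ->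
  (#|D| <= #|LS|)%N.
Proof.
move=> ex inj.
have [f Hf] : exists f : T -> {set T},
    forall u, u \in D -> f u \in LS /\ Rel u (f u).
  have /fin_all_exists[f Hf] : forall u, exists L, u \in D -> L \in LS /\ Rel u L.
    move=> u; case: (boolP (u \in D)) => [/ex[L LL RL]|_]; last by exists set0.
    by exists L.
  by exists f.
have f_inj : {in D &, injective f}.
  move=> u v uD vD fuv; have [_ Ru] := Hf u uD; have [_ Rv] := Hf v vD.
  by apply: inj uD vD Ru _; rewrite fuv.
rewrite -(card_in_imset f_inj); apply: subset_leq_card.
by apply/subsetP => _ /imsetP[u uD ->]; have [] := Hf u uD.
Qed.

Section Bounds.
Variable T : finType.
Implicit Types (s t u v w x y z : T) (L : {set T}).
Variables (a b : T -> int).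
Hypothesis ab_inj : forall s t, a s = a t -> b s = b t -> s = t.
Hypothesis a_conv : forall s t k, a s <= k <= a t -> exists w, a w = k.
Hypothesis nonuniv : forall u v, u != v -> exists w, w \notin ln a b u v.

Definition lns := [set ln a b st.1 st.2 | st in [pred st : T * T | st.1 != st.2]].

Lemma mem_lns u v : u != v -> ln a b u v \in lns.
Proof. by move=> uv; apply/imsetP; exists (u, v). Qed.

(** No column lies strictly between, so in a common row the line [st] would contain every point. *)
Lemma row_adj s t : a t = a s + 1 -> b s != b t.
Proof.
move=> st; apply/eqP => bst.
have /nonuniv[w] : s != t by apply/eqP => E; move: st; rewrite E; lia.
by rewrite inE /inbox; lia.
Qed.

Definition vcol : pred int :=
  fun j => [exists s, a s == j] && [exists s, a s == j + 1].

(** Take the smallest row difference: a point strictly between the rows would give a closer pair,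
    and [row_adj] handles the boundary row. *)
Lemma step_exists j : vcol j -> exists pq, step a b j pq.1 pq.2.
Proof.
case/andP => /existsP[s /eqP as_] /existsP[t /eqP at_].
have st : (a (s, t).1 == j) && (a (s, t).2 == j + 1) by rewrite /= as_ at_ !eqxx.
have [[p q] /= /andP[/eqP ap /eqP aq] Hpq] :=
  @arg_minP _ _ _ (s, t) (fun pq => (a pq.1 == j) && (a pq.2 == j + 1))
    (fun pq => `|b pq.1 - b pq.2|) st.
exists (p, q); split => //=; first by apply: row_adj; lia.
move=> w; split=> aw.
  have := Hpq (w, q); rewrite /= aw aq !eqxx => /(_ isT).
  by have := @row_adj w q; lia.
have := Hpq (p, w); rewrite /= aw ap !eqxx => /(_ isT).
by have := @row_adj p w; lia.
Qed.

(** The tops of all columns but the last stand for the [c - 1] pairs of adjacent columns. *)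
Definition front := [set t | [exists s, a s == a t + 1] &
  [forall w, (a w == a t) ==> (b w <= b t)]].

Lemma columns_bound t0 : (#|front| <= #|lns|)%N.
Proof.
have [PQ HPQ] : exists PQ : int -> T * T,
    forall j, vcol j -> step a b j (PQ j).1 (PQ j).2.
  have /choice[PQ H] : forall j, exists pq, vcol j -> step a b j pq.1 pq.2.
    move=> j; have [/step_exists[pq Hpq]|nj] := boolP (vcol j); first by exists pq.
    by exists (t0, t0).
  by exists PQ.
pose P j := (PQ j).1; pose Q j := (PQ j).2; pose nb t := - b t.
have HPQn j : vcol j -> step a nb j (P j) (Q j) by move/HPQ/step_negb.
have PQneq j : vcol j -> P j != Q j.
  by case/HPQ => _ _ bPQ _; apply: contraNneq bPQ; rewrite /P /Q => ->.
have vcolP t s : a s = a t + 1 -> vcol (a t).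
  by move=> st; apply/andP; split; apply/existsP; [exists t|exists s; apply/eqP].
pose E := ell a b P Q.
have En j : ell a nb P Q j = E j by exact: ln_negb.
(* The last step with a given line keeps it; the others get a crossing line, taken with the rows
   reversed if the step goes down. *)
pose last j L := L = E j /\ forall k, j < k -> vcol k -> E k <> E j.
pose Rel t L := [\/ last (a t) L,
  exists i' z, cross a b P Q vcol (a t) i' z L |
  exists i' z, cross a nb P Q vcol (a t) i' z L].
have dir j : vcol j -> b (P j) < b (Q j) \/ nb (P j) < nb (Q j).
  case/HPQ => _ _; rewrite -/(P j) -/(Q j) neq_lt => /orP[up|dn] _; first by left.
  by right; rewrite /nb ltrN2.
apply: (@card_le_rel _ _ _ Rel) => [u|u v L]; rewrite ?inE.
  case/andP => /existsP[s /eqP us] _; have vu := vcolP _ _ us.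
  case: (boolP [exists t, [&& a u < a t, vcol (a t) & E (a t) == E (a u)]]);
      last first.
    rewrite negb_exists => /forallP nolater.
    exists (E (a u)); first exact: mem_lns (PQneq _ vu).
    apply: Or31; split=> // k uk vk Ek; have /andP[/existsP[t /eqP tk] _] := vk.
    by move: (nolater t); rewrite tk uk vk Ek eqxx.
  case/existsP => t0' Ht0'.
  have [t /and3P[ut vt /eqP Et] Ht] := @arg_minP _ _ _ t0'
    (fun t => [&& a u < a t, vcol (a t) & E (a t) == E (a u)]) a Ht0'.
  have nx : forall c, ell a c P Q = E -> next a c P Q vcol (a u) (a t).
    move=> c Ec; split=> // [|k /andP[uk kt] vk]; rewrite Ec //.
    have /andP[/existsP[w /eqP wk] _] := vk; apply/eqP => Ek.
    by move: (Ht w); rewrite wk uk vk Ek eqxx => /(_ isT); lia.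
  have [w Hw] := nonuniv (PQneq _ vu).
  have [up|dn] := dir _ vu.
    have [z [L C]] := cross_exists HPQ vu up (nx b erefl) (ex_intro _ w Hw).
    have [x [y [xy _ LE _]]] := cross_corner HPQ C.
    exists L; last by apply: Or32; exists (a t), z.
    by rewrite LE; apply: mem_lns; apply: contraTneq xy => ->; rewrite ltxx.
  have Enb : ell a nb P Q = E by apply/funext => j; exact: En.
  have Hw' : w \notin ell a nb P Q (a u) by rewrite Enb.
  have [z [L C]] := cross_exists HPQn vu dn (nx nb Enb) (ex_intro _ w Hw').
  have [x [y [xy _ LE _]]] := cross_corner HPQn C.
  exists L; last by apply: Or33; exists (a t), z.
  rewrite LE ln_negb; apply: mem_lns.
  by apply: contraTneq xy => ->; rewrite ltxx.
case/andP=> /existsP[u1 /eqP au1] /forallP topu.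
case/andP=> /existsP[v1 /eqP av1] /forallP topv.
have [vu vv] := (vcolP _ _ au1, vcolP _ _ av1).
move=> Ru Rv; suff auv : a u = a v.
  apply: ab_inj => //; apply/le_anti/andP; split.
    by move: (topv u); rewrite auv eqxx.
  by move: (topu v); rewrite auv eqxx.
have CE i' z j k : cross a b P Q vcol j i' z (E k) -> vcol k -> False.
  by move=> C vk; case: (cross_ell HPQ C vk).
have CEn i' z j k : cross a nb P Q vcol j i' z (E k) -> vcol k -> False.
  by move=> C vk; case: (cross_ell HPQn C vk); rewrite En.
(* In [b] the first line decreases and the second increases, so if equal they would supply the
   corner that [cross_corner] excludes. *)
have CC i i' z j j' x L' : cross a b P Q vcol i i' z L' ->
    cross a nb P Q vcol j j' x L' -> False.
  move=> C C'; have [x1 [y1 [a1 b1 E1 cor]]] := cross_corner HPQ C.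
  have [x2 [y2 [a2 b2 E2 _]]] := cross_corner HPQn C'.
  rewrite ln_negb E1 in E2; have {}b2 : b x2 < b y2 by move: b2; rewrite /nb; lia.
  have [e1 e2 e3 e4] := ln_rectangle a1 b1 a2 b2 E2.
  by case: cor => [/(_ y2)|/(_ x2)]; rewrite ?e1 ?e2 ?e3 ?e4 !eqxx.
case: Ru => [[LE lu]|[i' [z C]]|[i' [z C]]];
  case: Rv => [[LE' lv]|[j' [x C']]|[j' [x C']]].
- have [uv|vu'|//] := ltgtP (a u) (a v).
    by case: (lu _ uv vv); rewrite -LE'.
  by case: (lv _ vu' vu); rewrite -LE.
- by rewrite LE in C'; case: (CE _ _ _ _ C' vu).
- by rewrite LE in C'; case: (CEn _ _ _ _ C' vu).
- by rewrite LE' in C; case: (CE _ _ _ _ C vv).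
- exact: (cross_inj HPQ C C').
- by case: (CC _ _ _ _ _ _ _ C C').
- by rewrite LE' in C; case: (CEn _ _ _ _ C vv).
- by case: (CC _ _ _ _ _ _ _ C' C).
- exact: (cross_inj HPQn C C').
Qed.

End Bounds.

(** * Counting strips *)

Section Strips.
Variables (T : finType) (b : T -> int).
Implicit Types (a : T -> int) (s t u v w x y z : T) (L : {set T}).

Definition above a u u' :=
  [/\ a u' = a u, b u < b u' & forall w, a w = a u -> ~~ (b u < b w < b u')].

(* [z] is the leftmost, then lowest, point to the right of [u] in the strip of
   rows strictly between [u] and [u']. *)
Definition right_of a u u' z :=
  [/\ above a u u', a u < a z, b u < b z < b u' &
      forall w, a u < a w -> b u < b w < b u' ->
        (a z < a w) || ((a z == a w) && (b z <= b w))].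

Lemma right_of_ln a u u' z w : right_of a u u' z ->
  (w \in ln a b u z) = icomp a b w u && icomp a b w z.
Proof. by case=> _ uz /andP[bz _] _; exact: ln_inc. Qed.

Lemma right_of_notin a u u' z : right_of a u u' z -> u' \notin ln a b u z.
Proof.
move=> H; rewrite (right_of_ln _ H); case: H => -[au' _ _] uz bz _.
by rewrite /icomp; lia.
Qed.

(** If [x] were above [u], then [u'] would be at or below [x] in the same column, hence on
    [ln a b x y]. *)
Lemma right_of_col a u u' z x x' y :
  right_of a u u' z -> right_of a x x' y -> ln a b u z = ln a b x y ->
  a u = a x -> b x <= b u.
Proof.
move=> Hu Hx E ux; rewrite leNgt; apply/negP => bux.
have := right_of_notin Hu; rewrite E (right_of_ln _ Hx).
case: Hu => -[au' bu' Hu'] _ _ _; case: Hx => _ xy bxy _.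
by move: (Hu' x); rewrite /icomp; lia.
Qed.

(** As [x] is on the line and [x'] is not, [b x <= b u < b x']; with [b x < b u], the point [u]
    would precede [y] in the choice for [x]. A lower point in the columns between would be on
    [ln a b u z] only. *)
Lemma right_of_row a u u' z x x' y :
  right_of a u u' z -> right_of a x x' y -> ln a b u z = ln a b x y ->
  a x < a u -> b x = b u /\ forall w, a x < a w <= a u -> b u <= b w.
Proof.
move=> Hu Hx E xu.
have := mem_lnl a b x y; rewrite -{1}E (right_of_ln _ Hu) => /andP[xu1 _].
have {xu1} bxu : b x <= b u by move: xu1; rewrite /icomp; lia.
have := mem_lnl a b u z; rewrite {1}E (right_of_ln _ Hx) => /andP[_ uy].
have := right_of_notin Hu; rewrite E (right_of_ln _ Hx).
have := right_of_notin Hx; rewrite -E (right_of_ln _ Hu).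
have [[au' bu' _] uz bz _] := Hu; have [[ax' bx' _] xy bxy near] := Hx.
move=> x'L u'L.
have bux' : b u < b x' by move: x'L; rewrite /icomp; lia.
have {}uy : (a u < a y) && (b u <= b y < b u') by move: u'L uy; rewrite /icomp; lia.
have bE : b x = b u by move: (near u); lia.
split=> // w xw; rewrite leNgt; apply/negP => bw.
have : w \in ln a b u z by rewrite (right_of_ln _ Hu) /icomp; lia.
by rewrite E (right_of_ln _ Hx) /icomp; lia.
Qed.

(* The low row condition and the points above the ends hold for the horizontal
   lines that replace a repeated line [ln u z]; they are what separates those
   from every other line. *)
Definition seg a l r L :=
  [/\ a l < a r, b l = b r, (exists l', above a l l') /\ (exists r', above a r r'),
      forall w, a l < a w < a r -> b l <= b w & L = ln a b l r].

Lemma seg_ln a l r L w : seg a l r L ->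
  (w \in L) = [|| a w <= a l, a r <= a w | b w == b l].
Proof. by case=> lr blr _ _ ->; rewrite inE /inbox; lia. Qed.

Lemma above_nega a u u' : above a u u' -> above (fun t => - a t) u u'.
Proof. by case=> au bu H; split=> [||w]; [lia|lia|move: (H w); lia]. Qed.

Lemma seg_nega a l r L : seg a l r L -> seg (fun t => - a t) r l L.
Proof.
case=> lr blr [[l' Hl] [r' Hr]] H ->; split.
- lia.
- by [].
- by split; [exists r'|exists l']; exact: above_nega.
- by move=> w; move: (H w); lia.
- by rewrite ln_nega lnC.
Qed.

Lemma opp_funK a : (fun t => - - a t) = a.
Proof. by apply/funext => t; exact: opprK. Qed.

Lemma seg_of_nega a l r L : seg (fun t => - a t) r l L -> seg a l r L.
Proof. by move/seg_nega; rewrite /= opp_funK. Qed.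

Lemma above_of_nega a u u' : above (fun t => - a t) u u' -> above a u u'.
Proof. by move/above_nega; rewrite /= opp_funK. Qed.

(** [L] contains [u] but not [u'], so [u] is in the row of [l], strictly between the end columns.
    Then [l'] is on [L], yet strictly above and left of [u]. *)
Lemma seg_right_of a l r L u u' z :
  seg a l r L -> right_of a u u' z -> L <> ln a b u z.
Proof.
move=> S H E; have := right_of_notin H; have := mem_lnl a b u z.
rewrite -{1}E -E !(seg_ln _ S).
case: S (seg_ln) => lr blr [[l' [al' bl' _]] _] _ LE _.
have : l' \in ln a b u z by rewrite -E LE inE /inbox; lia.
rewrite (right_of_ln _ H); case: H => -[au' bu' _] uz bz _.
by rewrite /icomp; lia.
Qed.

Definition leftmost a u L :=
  exists u' z, [/\ right_of a u u' z, L = ln a b u z &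
    forall x x' y, right_of a x x' y -> a x < a u -> ln a b x y <> L].

(** The horizontal line replacing one already produced by [x]. The strip point of [x] serves in
    [repeated_mirror], the last clause singles out [u] in its column. *)
Definition repeated a u L := exists x, [/\ seg a x u L,
  exists x' y, right_of a x x' y, exists u' z, right_of a u u' z &
  forall w, a w = a u -> b u <= b w].

Lemma leftmost_or_repeated a u u' z : right_of a u u' z ->
  exists2 L, (exists2 v, u != v & L = ln a b u v) & leftmost a u L \/ repeated a u L.
Proof.
move=> Hu.
have [[x [x' [y [Hx xu E]]]]|none] := EM (exists x x' y,
  [/\ right_of a x x' y, a x < a u & ln a b u z = ln a b x y]).
  have [bxu low] := right_of_row Hu Hx E xu.
  exists (ln a b u x); first by exists x => //; apply: contraTneq xu => ->; rewrite ltxx.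
  right; exists x; split.
  - split=> //; last exact: lnC.
      by split; [exists x'; case: Hx|exists u'; case: Hu].
    by move=> w /andP[xw wu]; rewrite bxu; apply: low; rewrite xw ltW.
  - by exists x', y.
  - by exists u', z.
  - by move=> w wu; apply: low; rewrite wu xu lexx.
exists (ln a b u z).
  exists z => //; case: Hu => _ uz _ _.
  by apply: contraTneq uz => ->; rewrite ltxx.
left; exists u', z; split=> // x x' y Hx xu E; apply: none.
by exists x, x', y.
Qed.

Lemma leftmost_inj a u v L : (forall s t, a s = a t -> b s = b t -> s = t) ->
  leftmost a u L -> leftmost a v L -> u = v.
Proof.
move=> inj [u' [z [Hu EL minu]]] [v' [y [Hv EL' minv]]].
have E : ln a b u z = ln a b v y by rewrite -EL -EL'.
have [uv|vu|uv] := ltgtP (a u) (a v).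
- by case: (minv _ _ _ Hu uv).
- by case: (minu _ _ _ Hv vu).
- apply: inj => //; apply/le_anti/andP.
  by rewrite (right_of_col Hu Hv E uv) (right_of_col Hv Hu (esym E) (esym uv)).
Qed.

(** By [ln_rectangle], [y] would be in the column of [u] and the row of [z], so between [u] and
    [u']. *)
Lemma leftmost_mirror a u v L :
  leftmost a u L -> leftmost (fun t => - a t) v L -> False.
Proof.
move=> [u' [z [Hu EL _]]] [v' [y [Hv EL' _]]].
case: Hu Hv => -[au' bu' Hu'] uz bz _ [[av' bv' _]] yv by' _.
have {}yv : a y < a v by lia.
have {}by' : b v < b y by lia.
have {}EL' : L = ln a b y v by rewrite EL' ln_nega lnC.
have /andP[buz bzu'] := bz.
have [e1 e2 e3 e4] := ln_rectangle yv by' uz buz (etrans (esym EL') EL).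
by move: (Hu' y); lia.
Qed.

(** * Recovering the ends of a horizontal segment from its line *)

Section Extremes.
Variable a : T -> int.
Hypothesis a_conv : forall s t k, a s <= k <= a t -> exists w, a w = k.
Hypothesis adj : forall s t, a t = a s + 1 -> b s != b t.

(** By [adj], the ends are not in adjacent columns and their neighbouring columns have no point in
    their row. Such points, missed by [L], reveal the end columns. *)
Lemma seg_gap l r L : seg a l r L ->
  (exists g, [/\ a g = a l + 1, a l < a g < a r & b g != b l]) /\
  (exists g, [/\ a g = a r - 1, a l < a g < a r & b g != b l]).
Proof.
case=> lr blr _ _ _; have lr1 : a r <> a l + 1.
  by move=> e; have := adj e; rewrite blr eqxx.
split.
  have [|g ag] := a_conv (s := l) (t := r) (k := a l + 1); first by lia.
  exists g; split=> //; first by lia.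
  by rewrite eq_sym; exact: adj.
have [|g ag] := a_conv (s := l) (t := r) (k := a r - 1); first by lia.
exists g; split=> //; first by lia.
by rewrite blr; apply: adj; lia.
Qed.

Lemma seg_cols_le l r l' r' L : seg a l r L -> seg a l' r' L ->
  a l' <= a l /\ a r <= a r'.
Proof.
move=> S S'; have [[g [ag g_in bg]] [h [ah h_in bh]]] := seg_gap S.
have outL w : a l < a w < a r -> b w != b l -> a l' < a w < a r'.
  move=> /andP[lw wr] /negPf bw; have := seg_ln w S; rewrite (seg_ln w S').
  rewrite [a w <= a l]leNgt lw [a r <= a w]leNgt wr bw /= => /negbT.
  by rewrite !negb_or -!ltNge => /and3P[-> ->].
have := outL g g_in bg; have := outL h h_in bh.
by clear outL S S' g_in h_in bg bh; lia.
Qed.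

Lemma seg_cols l r l' r' L : seg a l r L -> seg a l' r' L ->
  a l = a l' /\ a r = a r'.
Proof.
move=> S S'; have [h1 h2] := seg_cols_le S S'.
by have [h3 h4] := seg_cols_le S' S; split; apply/le_anti; rewrite ?h1 ?h2 ?h3 ?h4.
Qed.

Lemma repeated_inj u v L : (forall s t, a s = a t -> b s = b t -> s = t) ->
  repeated a u L -> repeated a v L -> u = v.
Proof.
move=> inj [x [Su _ _ lowu]] [y [Sv _ _ lowv]].
have [_ uv] := seg_cols Su Sv; apply: inj => //; apply/le_anti/andP.
by rewrite (lowu v) // (lowv u).
Qed.

(** The end columns agree and the ends given lines are lowest in their columns, so [v] is the point
    [x] that [u] repeats. *)
Lemma repeated_mirror u v L : (forall s t, a s = a t -> b s = b t -> s = t) ->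
  repeated a u L -> repeated (fun t => - a t) v L ->
  exists z' z, right_of a v z' z.
Proof.
move=> inj [x [Su [x' [y Hx]] _ lowu]] [w [Sv _ _ lowv]].
have Sv' := seg_of_nega Sv.
have [xv uw] := seg_cols Su Sv'; suff -> : v = x by exists x', y.
have bux : b x = b u by case: Su.
have bvw : b v = b w by case: Sv'.
apply: inj => //; apply/le_anti/andP; split; first by apply: lowv; lia.
by rewrite bvw bux; apply: lowu; lia.
Qed.

End Extremes.
End Strips.

Section StripBound.
Variables (T : finType) (a b : T -> int).
Implicit Types (s t u v w x y z : T) (L : {set T}).
Hypothesis ab_inj : forall s t, a s = a t -> b s = b t -> s = t.
Hypothesis a_conv : forall s t k, a s <= k <= a t -> exists w, a w = k.
Hypothesis nonuniv : forall u v, u != v -> exists w, w \notin ln a b u v.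
Let na t := - a t.

Let adj s t : a t = a s + 1 -> b s != b t.
Proof. exact: row_adj. Qed.

Definition upclosed (c : T -> int) L :=
  forall u u', above b c u u' -> u \in L -> u' \in L.

Definition split_line L :=
  (exists u, leftmost b a u L \/ leftmost b na u L) \/ (exists l r, seg b a l r L).

Lemma upclosed_split L : upclosed a L -> (forall l r, ~ seg b a l r L) ->
  ~ split_line L.
Proof.
move=> up noseg [[u [[u' [z [H E _]]]|[u' [z [H E _]]]]]|[l [r S]]].
- have := right_of_notin H; rewrite -E (up u u') ?E ?mem_lnl //; by case: H.
- have := right_of_notin H; rewrite -E (up u u') ?E ?mem_lnl //.
  by apply: above_of_nega; case: H.
- exact: noseg S.
Qed.

End StripBound.

(** * Lines closed under moving up *)

Section Extra.
Variables (T : finType) (b : T -> int).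
Implicit Types (a : T -> int) (s t u v w x y z : T) (L : {set T}).

(** Below the top row, the line consists of the points from column [a p] on that are not below [q]
    or are in the last column. *)
Lemma corner_upclosed a p q :
  (forall w, b w <= b p) -> (forall w, a w <= a q) -> a p < a q -> b q < b p ->
  upclosed b a (ln a b p q).
Proof.
move=> Hp Hq pq bqp u u' [au bu _]; rewrite !(ln_dec _ pq bqp) /dcomp.
by move: (Hp u) (Hp u') (Hq u); lia.
Qed.

(** [l] is on the line and, because of [l'], below the top row; so the higher point [g] in the next
    column is on it too, unlike for a segment. *)
Lemma corner_seg a p q l r :
  (forall s t k, a s <= k <= a t -> exists w, a w = k) ->
  (forall s t, a t = a s + 1 -> b s != b t) ->
  (forall w, b w <= b p) -> (forall w, a w <= a q) -> a p < a q -> b q < b p ->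
  ~ seg b a l r (ln a b p q).
Proof.
move=> conv adj Hp Hq pq bqp S.
have [[g [ag lgr bg]] _] := seg_gap conv adj S.
have := seg_ln g S; have := seg_ln l S; rewrite !(ln_dec _ pq bqp) /dcomp.
case: S => lr blr [[l' [al' bl' _]] _] low _.
by move: (low g lgr) (Hp l') (Hp g) (Hq r); lia.
Qed.

End Extra.

Section Count.
Variables (T : finType) (a b : T -> int).
Implicit Types (s t u v w x y z : T) (L : {set T}).
Hypothesis ab_inj : forall s t, a s = a t -> b s = b t -> s = t.
Hypothesis a_conv : forall s t k, a s <= k <= a t -> exists w, a w = k.
Hypothesis nonuniv : forall u v, u != v -> exists w, w \notin ln a b u v.
Let na t := - a t.

Let adj s t : a t = a s + 1 -> b s != b t.
Proof. exact: row_adj. Qed.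

Let na_inj s t : na s = na t -> b s = b t -> s = t.
Proof. by move=> /oppr_inj; exact: ab_inj. Qed.

Let na_conv s t k : na s <= k <= na t -> exists w, na w = k.
Proof.
move=> H; have [|w aw] := @a_conv t s (- k); first by move: H; rewrite /na; lia.
by exists w; rewrite /na aw opprK.
Qed.

Let na_adj s t : na t = na s + 1 -> b s != b t.
Proof. by move=> H; rewrite eq_sym; apply: adj; move: H; rewrite /na; lia. Qed.

Lemma extra_line u0 v0 : u0 != v0 ->
  exists L, [/\ L \in lns a b, upclosed b a L & forall l r, ~ seg b a l r L].
Proof.
move=> uv0.
have mx (c : T -> int) : exists p, forall w, c w <= c p.
  have [p _ H] := @arg_minP _ _ _ u0 predT (fun t => - c t) isT.
  by exists p => w; rewrite -lerN2; exact: H.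
have neq (c : T -> int) p q : c p < c q -> p != q.
  by move=> H; apply: contraTneq H => ->; rewrite ltxx.
have [[p [q [Hp Hq pq bqp]]]|no1] := EM (exists p q,
  [/\ forall w, b w <= b p, forall w, a w <= a q, a p < a q & b q < b p]).
  exists (ln a b p q); split; first exact: mem_lns (neq a _ _ pq).
    exact: corner_upclosed.
  by move=> l r; exact: corner_seg.
have [[p [q [Hp Hq pq bqp]]]|no2] := EM (exists p q,
  [/\ forall w, b w <= b p, forall w, na w <= na q, na p < na q & b q < b p]).
  exists (ln a b p q); split; first exact: mem_lns (neq na _ _ pq).
    rewrite -ln_nega => u u' H; apply: (corner_upclosed Hp Hq pq bqp).
    exact: above_nega.
  move=> l r /seg_nega; rewrite -ln_nega.
  exact: (corner_seg na_conv na_adj).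
have [p Hp] := mx b; have [q1 Hq1] := mx a; have [q0 Hq0] := mx na.
have edge1 q : (forall w, a w <= a q) -> a p < a q -> b q = b p.
  move=> Hq pq; apply/eqP/negPn/negP => bqp; apply: no1; exists p, q; split=> //.
  by have := Hp q; lia.
have edge0 q : (forall w, na w <= na q) -> na p < na q -> b q = b p.
  move=> Hq pq; apply/eqP/negPn/negP => bqp; apply: no2; exists p, q; split=> //.
  by have := Hp q; lia.
(* Without such corners, the top row meets the last column in [p1] and the first in [p0], and these
   columns have no lower points; the line [p0 p1] is just the top row. *)
have [p1 [bp1 ap1]] : exists p1, b p1 = b p /\ a p1 = a q1.
  have [pq|//] := ltP (a p) (a q1); first by exists q1; rewrite edge1.
  by exists p; split=> //; have := Hq1 p; lia.
have [p0 [bp0 ap0]] : exists p0, b p0 = b p /\ na p0 = na q0.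
  have [pq|//] := ltP (na p) (na q0); first by exists q0; rewrite edge0.
  by exists p; split=> //; have := Hq0 p; lia.
have {Hq1}Hp1 w : a w <= a p1 by rewrite ap1.
have {Hq0}Hp0 w : a p0 <= a w by rewrite -lerN2 -/(na w) -/(na p0) ap0.
have p01 : a p0 < a p1.
  rewrite lt_neqAle Hp0 andbT; apply/eqP => p01.
  have [w] := nonuniv uv0; rewrite inE /inbox.
  by move: (Hp0 u0) (Hp0 v0) (Hp0 w) (Hp1 u0) (Hp1 v0) (Hp1 w); lia.
have col w : a w <= a p0 \/ a p1 <= a w -> b w = b p.
  move=> H; apply/eqP/negPn/negP => bw; have := Hp w; case: H => aw bwp.
    apply: no2; exists p1, w; rewrite bp1; split=> // [w'||]; rewrite ?/na.
    - by have := Hp0 w'; lia.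
    - by lia.
    - by lia.
  apply: no1; exists p0, w; rewrite bp0; split=> // [w'||].
  - by have := Hp1 w'; lia.
  - by lia.
  - by lia.
have Lw w : (w \in ln a b p0 p1) -> b w = b p.
  have [/orP[]|] := boolP ((a w <= a p0) || (a p1 <= a w)).
  - by move=> H _; apply: col; left.
  - by move=> H _; apply: col; right.
  - by rewrite inE /inbox bp0 bp1; lia.
exists (ln a b p0 p1); split; first exact: mem_lns (neq a _ _ p01).
  by move=> u u' [_ bu _] /Lw; have := Hp u'; lia.
move=> l r [_ _ [[l' [_ bl _]] _] _ E].
by have := Lw l; rewrite E mem_lnl => /(_ isT); have := Hp l'; lia.
Qed.

Definition nontop := [set u | [exists w, (a w == a u) && (b u < b w)]].

Lemma right_of_exists (c : T -> int) u u' x : above b c u u' -> b u < b x < b u' ->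
  c u < c x -> exists z, right_of b c u u' z.
Proof.
move=> H bx ux.
have Px : (c u < c x) && (b u < b x < b u') by rewrite ux.
have [y /andP[uy by_] ymin] := @arg_minP _ _ _ x
  (fun t => (c u < c t) && (b u < b t < b u')) c Px.
have Py : (c y == c y) && (b u < b y < b u') by rewrite eqxx.
have [z /andP[/eqP zy bz] zmin] := @arg_minP _ _ _ y
  (fun t => (c t == c y) && (b u < b t < b u')) b Py.
exists z; split=> //; first by rewrite zy.
move=> w uw bw; rewrite zy.
have [yw|wy|wy] := ltgtP (c y) (c w) => //=.
  by have := ymin w; rewrite uw bw => /(_ isT); lia.
by apply: zmin; rewrite -wy eqxx.
Qed.

(** The mirrored choice is made only when there is no strip point to the right, which
    [repeated_mirror] contradicts. *)
Definition strip_line u L :=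
  (leftmost b a u L \/ repeated b a u L) \/
  (forall u' z, ~ right_of b a u u' z) /\
    (leftmost b na u L \/ repeated b na u L).

Lemma strip_line_exists u : u \in nontop ->
  exists2 L, L \in lns a b & strip_line u L.
Proof.
rewrite inE => /existsP[w0 Pw0].
have [u' /andP[/eqP au' bu'] u'min] := @arg_minP _ _ _ w0
  (fun t => (a t == a u) && (b u < b t)) b Pw0.
have ab : above b a u u'.
  split=> // w aw; apply/negP => /andP[bw bw'].
  by have := u'min w; rewrite aw eqxx bw => /(_ isT); lia.
have [[u1 [z Hz]]|nor] := EM (exists u1 z, right_of b a u u1 z).
  have [L [v uv ->] HL] := leftmost_or_repeated Hz.
  by exists (ln a b u v); [exact: mem_lns|left].
have uu' : u != u' by apply: contraTneq bu' => <-; rewrite ltxx.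
have [x] := nonuniv uu'.
have abu : above b na u u' := above_nega ab.
move=> xL; have [bx ax] : b u < b x < b u' /\ a u != a x.
  by move: xL; rewrite inE /inbox; lia.
have xu : na u < na x.
  rewrite /na ltrN2 ltNge; apply/negP => ux; apply: nor; exists u'.
  by apply: (right_of_exists ab bx); lia.
have [z Hz] := right_of_exists abu bx xu.
have [L [v uv LE] HL] := leftmost_or_repeated Hz.
exists L; first by rewrite LE ln_nega; exact: mem_lns.
right; split=> // u1 y Hy; apply: nor; by exists u1, y.
Qed.

Lemma repeated_leftmost (c : T -> int) u v L :
  repeated b c u L -> leftmost b c v L -> False.
Proof. by case=> x [S _ _ _] [v' [z [H E _]]]; apply: seg_right_of S H E. Qed.

Lemma repeated_leftmost_nega (c : T -> int) u v L :
  repeated b c u L -> leftmost b (fun t => - c t) v L -> False.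
Proof. by case=> x [/seg_nega S _ _ _] [v' [z [H E _]]]; apply: seg_right_of S H E. Qed.

Lemma strip_line_inj u v L : strip_line u L -> strip_line v L -> u = v.
Proof.
have one (c : T -> int) x y :
    (forall s t, c s = c t -> b s = b t -> s = t) ->
    (forall s t k, c s <= k <= c t -> exists w, c w = k) ->
    (forall s t, c t = c s + 1 -> b s != b t) ->
    leftmost b c x L \/ repeated b c x L ->
    leftmost b c y L \/ repeated b c y L -> x = y.
  move=> inj conv cadj [Hx|Hx] [Hy|Hy].
  - exact: leftmost_inj inj Hx Hy.
  - by case: (repeated_leftmost Hy Hx).
  - by case: (repeated_leftmost Hx Hy).
  - exact: (repeated_inj conv cadj inj Hx Hy).
have two x y : leftmost b a x L \/ repeated b a x L ->
    (forall y' z, ~ right_of b a y y' z) /\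
      (leftmost b na y L \/ repeated b na y L) -> x = y.
  move=> [Hx|Hx] [nor [Hy|Hy]].
  - by case: (leftmost_mirror Hx Hy).
  - by case: (repeated_leftmost_nega (v := x) Hy); rewrite /na opp_funK.
  - by case: (repeated_leftmost_nega Hx Hy).
  - have [z' [z Hz]] := repeated_mirror a_conv adj ab_inj Hx Hy.
    by case: (nor z' z).
move=> [Hu|Hu] [Hv|Hv].
- exact: (one a).
- exact: two.
- by apply/esym; exact: two.
- by case: Hu Hv => [_ Hu] [_ Hv]; exact: (one na).
Qed.

Lemma strips_bound u0 v0 : u0 != v0 -> (#|nontop|.+1 <= #|lns a b|)%N.
Proof.
move=> /extra_line[L0 [L0in up noseg]].
(* Set the extra line [L0] aside and inject [nontop] into the other lines. *)
rewrite [X in (_ <= X)%N](cardsD1 L0) L0in add1n ltnS.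
apply: (@card_le_rel _ _ _ strip_line) => [u /strip_line_exists[L Lin HL]|u v L _ _];
  last exact: strip_line_inj.
exists L => //; rewrite !inE Lin andbT; apply/eqP => E; rewrite E in HL.
apply: (upclosed_split (a := a) up noseg).
case: HL => [[H|H]|[_ [H|H]]].
- by left; exists u; left.
- by right; case: H => x [S _ _ _]; exists x, u.
- by left; exists u; right.
- right; by case: H => x [S _ _ _]; exists u, x; exact: seg_of_nega.
Qed.

(** Only the top [p] of the last column can be outside both sets. *)
Lemma nontop_front u0 : (#|T| <= (#|nontop| + #|front a b|).+1)%N.
Proof.
have [q _ Hq] := @arg_minP _ _ _ u0 predT (fun t => - a t) isT.
have [p /eqP ap Hp] := @arg_minP _ _ _ q
  (fun t => a t == a q) (fun t => - b t) (eqxx _).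
have sub : [set: T] \subset nontop :|: (p |: front a b).
  apply/subsetP => t _; rewrite !inE.
  case: (boolP [exists w, (a w == a t) && (b t < b w)]) => [//|ntop /=].
  have top w : a w = a t -> b w <= b t.
    move=> aw; rewrite leNgt; apply: contra ntop => bw.
    by apply/existsP; exists w; rewrite aw eqxx.
  have -> : [forall w, (a w == a t) ==> (b w <= b t)].
    by apply/forallP => w; apply/implyP => /eqP; exact: top.
  rewrite andbT; have [tq|tq] := boolP (a t == a q).
    apply/orP; left; apply/eqP; apply: ab_inj; first by rewrite ap; exact/eqP.
    by have := Hp t tq; have := top p; rewrite ap (eqP tq) => /(_ erefl); lia.
  apply/orP; right; have [|w aw] := @a_conv t q (a t + 1).
    by have := Hq t isT; lia.
  by apply/existsP; exists w; rewrite aw.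
rewrite -cardsT; apply: leq_trans (subset_leq_card sub) _.
apply: leq_trans (leq_card_setU _ _) _; rewrite -addnS leq_add2l cardsU1.
by case: (_ \notin _).
Qed.

Lemma lns_bound : #|T| <> 1%N -> (uphalf #|T| <= #|lns a b|)%N.
Proof.
move=> n1; have [->|n0] := eqVneq #|T| 0%N; first by [].
have [u0 _] : exists u0, u0 \in [set: T] by apply/set0Pn; rewrite -card_gt0 cardsT lt0n.
have [v0 uv] : exists v0, v0 \in [set~ u0].
  by apply/set0Pn; rewrite -card_gt0 cardsC1; move: n0 n1; case: #|T| => [|[]].
have uv0 : u0 != v0 by move: uv; rewrite !inE eq_sym.
(* Adding the two bounds gives [#|T| <= 2 * #|lns a b|]. *)
have := strips_bound uv0; have := columns_bound ab_inj nonuniv u0.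
have := nontop_front u0; lia.
Qed.

End Count.

(** * Ranks of points of the plane *)

(** The rank is the index in the sorted list of distinct values, so ranks leave no gaps. *)
Lemma rank_exists (R : realDomainType) (T : finType) (f : T -> R) :
  exists a : T -> int, (forall s t, (a s <= a t) = (f s <= f t)) /\
    (forall s t k, a s <= k <= a t -> exists w, a w = k).
Proof.
pose S := sort <=%O (undup (codom f)).
have uS : uniq S by rewrite sort_uniq undup_uniq.
have memS t : f t \in S by rewrite mem_sort mem_undup codom_f.
exists (fun t => Posz (index (f t) S)); split=> [s t|s t [k|k]] //; last first.
  rewrite !lez_nat => /andP[_ kt].
  have kS : (k < size S)%N by apply: leq_ltn_trans kt _; rewrite index_mem.
  have := mem_nth 0 kS; rewrite mem_sort mem_undup => /codomP[w fw].
  by exists w; rewrite -fw index_uniq.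
have ltS : sorted <%O S by rewrite sort_lt_sorted undup_uniq.
have := lt_sorted_leq_nth 0 ltS (x := index (f s) S) (y := index (f t) S).
by rewrite !inE !index_mem !memS !nth_index // lez_nat => ->.
Qed.

Section Plane.
Variable R : realType.
Implicit Types (u v w x y z : R * R) (X : {fset (R * R)%type}).

Definition dsum u := u.1 + u.2.
Definition ddif u := u.1 - u.2.

Lemma max_norm (p q : R) : Num.max `|p| `|q| = (`|p + q| + `|p - q|) / 2.
Proof.
rewrite maxEle; case: leP; case: (ger0P p) => ?; case: (ger0P q) => ? ?;
  case: (ger0P (p + q)) => ?; case: (ger0P (p - q)) => ?; lra.
Qed.

Lemma linf_distE u v :
  linf_dist u v = (`|dsum u - dsum v| + `|ddif u - ddif v|) / 2.
Proof.
rewrite /linf_dist max_norm /dsum /ddif.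
have -> : u.1 - v.1 + (u.2 - v.2) = u.1 + u.2 - (v.1 + v.2) by lra.
by have -> : u.1 - v.1 - (u.2 - v.2) = u.1 - u.2 - (v.1 - v.2) by lra.
Qed.

Lemma dist_add (x z y : R) :
  (`|x - y| == `|x - z| + `|z - y|) = (x <= z <= y) || (y <= z <= x).
Proof.
case: (ger0P (x - y)) => ?; case: (ger0P (x - z)) => ?; case: (ger0P (z - y)) => ?;
  apply/idP/idP => ?; lra.
Qed.

(** The triangle inequality holds in each rotated coordinate, so equality of the sums forces it in
    both. *)
Lemma between_box x z y : x != y -> x != z -> z != y ->
  between x z y =
  ((dsum x <= dsum z <= dsum y) || (dsum y <= dsum z <= dsum x)) &&
  ((ddif x <= ddif z <= ddif y) || (ddif y <= ddif z <= ddif x)).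
Proof.
move=> xy xz zy; rewrite /between xy xz zy /= -!dist_add !linf_distE.
have := ler_distD (dsum z) (dsum x) (dsum y).
have := ler_distD (ddif z) (ddif x) (ddif y).
move=> h1 h2; apply/eqP/andP => [E|[/eqP-> /eqP->]]; last by lra.
by split; apply/eqP; lra.
Qed.

End Plane.

Section Transfer.
Variables (R : realType) (X : {fset (R * R)%type}).
Implicit Types (u v w : X).
Variables (a b : X -> int).
Hypothesis a_rank : forall u v, (a u <= a v) = (dsum (val u) <= dsum (val v)).
Hypothesis b_rank : forall u v, (b u <= b v) = (ddif (val u) <= ddif (val v)).

Lemma in_line u v w : u != v -> (val w \in line X (val u) (val v)) = (w \in ln a b u v).
Proof.
move=> uv; rewrite !inE /= (valP w) /= !(inj_eq val_inj).
have [->|wu] := eqVneq w u; first by rewrite /inbox; lia.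
have [->|wv] := eqVneq w v; first by rewrite /inbox; lia.
rewrite !between_box ?(inj_eq val_inj) // 1?eq_sym //.
by rewrite -!a_rank -!b_rank.
Qed.

Lemma rank_inj u v : a u = a v -> b u = b v -> u = v.
Proof.
move=> auv buv; apply: val_inj.
have ds : dsum (val u) = dsum (val v).
  by apply/le_anti; rewrite -!a_rank auv lexx.
have dd : ddif (val u) = ddif (val v).
  by apply/le_anti; rewrite -!b_rank buv lexx.
move: ds dd; rewrite /dsum /ddif; case: (val u) (val v) => [u1 u2] [v1 v2] /= ds dd.
by congr (_, _); lra.
Qed.

Lemma lines_mem u v : u != v -> line X (val u) (val v) \in lines X.
Proof.
move=> uv; apply/imfset2P; exists (val u); first exact: valP.
by exists (val v) => //; apply/andP; split; [exact: valP|rewrite (inj_eq val_inj)].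
Qed.

Lemma rank_nonuniv : (~ exists L, universal X L) ->
  forall u v, u != v -> exists w, w \notin ln a b u v.
Proof.
move=> nouniv u v uv; apply: contra_notP nouniv => allin.
exists (line X (val u) (val v)); rewrite /universal lines_mem //=.
apply/fsubsetP => x xX; have := in_line [` xX]%fset uv => /= ->.
by apply/negPn/negP => xL; apply: allin; exists [` xX]%fset.
Qed.

(** Every member of [lns a b] is the trace on [X] of a member of [lines X]. *)
Lemma card_lns : (#|lns a b| <= #|` lines X|)%N.
Proof.
pose trace (L : {fset (R * R)%type}) : {set X} := [set w | val w \in L].
rewrite cardfE; apply: leq_trans (leq_imset_card (fun L : lines X => trace (val L)) _).
apply: subset_leq_card; apply/subsetP => _ /imsetP[[u v] /= uv ->].
apply/imsetP; exists [` lines_mem uv]%fset => //.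
by apply/setP => w; rewrite [RHS]inE in_line.
Qed.

End Transfer.

Local Close Scope ring_scope.

Theorem theorem13 (R : realType) (n : nat) (X : {fset (R * R)%type})
  (cardX : #|` X|%fset = n)
  (n_neq1 : n <> 1)
  (no_universal : ~ exists L : {fset (R * R)%type}, universal X L) :
  (uphalf n <= #|` lines X|%fset)%N.
Proof.
have [a [a_rank a_conv]] := rank_exists (fun u : X => dsum (val u)).
have [b [b_rank _]] := rank_exists (fun u : X => ddif (val u)).
apply: leq_trans (card_lns a_rank b_rank).
move: cardX; rewrite cardfE => cardX; rewrite -cardX.
apply: lns_bound; last by rewrite cardX.
- exact: rank_inj.
- exact: a_conv.
- exact: rank_nonuniv.
Qed.
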